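(* Let $q$ be a power of an odd prime, $g$ a primitive element of $\mathbb F_q$ (a generator of $\mathbb F_q^*$), and suppose either $d=4k-1$ with $q\equiv1\pmod4$, or $d=4k+1$, where $k$ is a positive integer. Let $S_g=\{x\in\mathbb F_q^d: x_1^2+\cdots+x_d^2=g\}$. For every $A\subset S_g$, \[E(A)\ll\frac{|A|^3}{q}+q^{\frac{d-2}{2}}|A|^2.\]
   Context: $E(A)=|\{(a,b,c,e)\in A^4: a+b=c+e\}|$. $X\ll Y$ means $X\le CY$ with $C$ absolute (independent of $q$ and $A$). *)

(* Defs.v *)
From HB Require Import structures.
From mathcomp Require Import all_boot all_order all_algebra all_field.
Set Implicit Arguments. Unset Strict Implicit. Unset Printing Implicit Defensive.
Import Order.TTheory GRing.Theory Num.Theory.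
Local Open Scope ring_scope.

Definition sphere (F : finFieldType) (d : nat) (g : F) : {set 'rV[F]_d} :=
  [set x : 'rV[F]_d | \sum_(i < d) x 0 i ^+ 2 == g].

Definition energy (F : finFieldType) (d : nat) (A : {set 'rV[F]_d}) : nat :=
  #|[set t : ('rV[F]_d * 'rV[F]_d) * ('rV[F]_d * 'rV[F]_d) |
      [&& t.1.1 \in A, t.1.2 \in A, t.2.1 \in A, t.2.2 \in A &
          t.1.1 + t.1.2 == t.2.1 + t.2.2]]|.

(* Main.v *)
(* E(A) is at most the number of corners (a, b, c) in A^3 with
   (a - c).(b - c) = 0, since 2 is invertible and |a + b - c|^2 = g.
   For fixed c the vectors a - c with |a - c|^2 <> 0 lie on distinct lines, so
   the second-moment bound for orthogonality in F^d controls the corners with two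
   anisotropic sides.
   Corners with an isotropic side a - c are read on the cone x.x = g s^2 of
   F^(d+1), where (a, 1), (b, 1) and (a - c, 0) are isotropic vectors and the
   corner says that (b, 1) is orthogonal to (a - c, 0). The hypotheses on d, q
   and g make this quadratic form elliptic; on an elliptic cone the
   orthogonality relation has only small positive nontrivial eigenvalues (of
   order q^((d-1)/2 - 1), against q^((d-1)/2) for the negative ones). This
   one-sided bound is used twice: for 1_A, to bound the number of isotropic
   pairs of A, and for 1_A plus |A|^-1 times the distribution of isotropic
   differences. The sizes below q^((d-2)/2) are covered by E(A) <= |A|^3. *)
Require Import Defs.
From HB Require Import structures.
From mathcomp Require Import all_boot all_order all_algebra all_field.
From mathcomp Require Import Rstruct.
From mathcomp Require Import ring lra zify.
Set Implicit Arguments. Unset Strict Implicit. Unset Printing Implicit Defensive.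
Import Order.TTheory GRing.Theory Num.Theory.
Local Open Scope ring_scope.

(** * Counting by slicing along parallel lines *)

(** On each line of [U] in the direction [w] the function [f] is affine with nonzero slope, so it
    has exactly one zero among the [#|F|] points. The counts of orthogonal and isotropic vectors
    below all come from this. *)
Lemma card_slice (F : finFieldType) (V : finLmodType F) (U : {set V}) (w : V)
    (f c : V -> F) :
  (forall v t, v \in U -> v + t *: w \in U) ->
  (forall v t, v \in U -> f (v + t *: w) = f v + t * c v) ->
  (forall v, v \in U -> c v != 0) ->
  #|U| = (#|[set v in U | f v == 0%R]| * #|F|)%N.
Proof.
move=> clU fU c_neq0; set Z := [set v in U | f v == 0].
have -> : U = [set p.1 + p.2 *: w | p in setX Z [set: F]].
  apply/setP=> v; apply/idP/imsetP => [Uv|[[z t] /setXP[/setIdP[Uz _] _] ->]].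
    exists (v + (- (f v / c v)) *: w, f v / c v); last first.
      by rewrite /= scaleNr subrK.
    rewrite !inE /= andbT clU //= fU // mulNr divfK ?c_neq0 // subrr eqxx //.
  exact: clU.
rewrite card_in_imset ?cardsX ?cardsT // => -[v t] [v' t'].
move=> /setXP[/setIdP[Uv /eqP fv] _] /setXP[/setIdP[Uv' /eqP fv'] _] /= E.
have Ev : v = v' + (t' - t) *: w.
  by apply/(addIr (t *: w)); rewrite E scalerBl -addrA subrK.
have := fU v' (t' - t) Uv'; rewrite -Ev fv fv' add0r => /esym/eqP.
rewrite mulf_eq0 (negPf (c_neq0 _ _)) // orbF subr_eq0 => /eqP tt'.
by rewrite Ev tt' subrr scale0r addr0.
Qed.

(** * Orthogonality in a finite quadratic space *)

Section OrthogonalGeometry.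

Variables (F : finFieldType) (V : finLmodType F) (B : V -> V -> F).
Hypothesis two_neq0 : (2%:R : F) != 0.
Hypothesis BC : forall u v, B u v = B v u.
Hypothesis BD : forall u v w, B u (v + w) = B u v + B u w.
Hypothesis BZ : forall u t v, B u (t *: v) = t * B u v.
Hypothesis B_nondeg : forall u, (forall v, B u v = 0) -> u = 0.

Definition perp u := [set v | B u v == 0].
Definition isotropic := [set v | B v v == 0].
Definition collinear (u v : V) := [exists t : F, u == t *: v].

Lemma card_perp u : u != 0 -> #|V| = (#|perp u| * #|F|)%N.
Proof.
move=> u0; have [w Bw] : exists w, B u w != 0.
  apply/existsP; apply: contraR u0; rewrite negb_exists => /forallP B0.
  by apply/eqP/B_nondeg => v; apply/eqP; move: (B0 v); rewrite negbK.
rewrite -cardsT (@card_slice F V [set: V] w (B u) (fun=> B u w)) //.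
- by congr (#|pred_of_set _| * _)%N; apply/setP=> v; rewrite !inE.
- by move=> v t _; rewrite inE.
- by move=> v t _; rewrite BD BZ.
Qed.

Lemma card_perpI u u' : u' != 0 -> ~~ collinear u u' ->
  #|perp u'| = (#|perp u :&: perp u'| * #|F|)%N.
Proof.
move=> u0 ncol; have [w1 Bw1] : exists w, B u' w != 0.
  apply/existsP; apply: contraR u0; rewrite negb_exists => /forallP B0.
  by apply/eqP/B_nondeg => v; apply/eqP; move: (B0 v); rewrite negbK.
have [w /andP[/eqP Bw' Bw]] : exists w, (B u' w == 0) && (B u w != 0).
  apply/existsP; apply: contraR ncol; rewrite negb_exists => /forallP B0.
  (* If [B u] vanished on [perp u'], it would be this multiple of [B u'], and nondegeneracy would
     make [u] the same multiple of [u']. *)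
  apply/existsP; exists (B u w1 / B u' w1).
  rewrite -subr_eq0 -scaleNr; apply/eqP.
  apply: B_nondeg => v; have := B0 (v + (- (B u' v / B u' w1)) *: w1).
  rewrite !BD !BZ mulNr divfK // subrr eqxx /= negbK => /eqP Bv.
  rewrite BC BD BZ BC (BC v u'); rewrite -[RHS]Bv; field.
  exact: Bw1.
rewrite (@card_slice F V (perp u') w (B u) (fun=> B u w)) //.
- by congr (#|pred_of_set _| * _)%N; apply/setP=> v; rewrite !inE andbC.
- by move=> v t; rewrite !inE BD BZ Bw' mulr0 addr0.
- by move=> v t _; rewrite BD BZ.
Qed.

Lemma form_shift u v t : u \in isotropic ->
  B (v + t *: u) (v + t *: u) = B v v + t * (2%:R * B u v).
Proof.
rewrite inE => /eqP Bu; rewrite BD BZ BC BD BZ (BC (_ + _)) BD BZ Bu (BC v u).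
ring.
Qed.

(** By [form_shift] the quadratic form is affine along an isotropic [u], with slope [2 * B u v].
    This is nonzero off [perp u], so every line parallel to [u] there carries exactly one isotropic
    vector. *)
Lemma card_isotropicD_perp (U : {set V}) u : u \in isotropic ->
  (forall v t, v \in U -> v + t *: u \in U) ->
  #|U :\: perp u| = (#|(isotropic :&: U) :\: perp u| * #|F|)%N.
Proof.
move=> isou clU; have Bu : B u u = 0 by move: isou; rewrite inE => /eqP.
rewrite (@card_slice F V _ u (fun v => B v v) (fun v => 2%:R * B u v)).
- congr (#|pred_of_set _| * _)%N; apply/setP=> v; rewrite !inE.
  by rewrite -andbA; congr (_ && _); rewrite andbC.
- move=> v t; rewrite !inE BD BZ Bu mulr0 addr0 => /andP[-> Uv] /=.
  exact: clU.
- by move=> v t _; exact: form_shift.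
- by move=> v; rewrite !inE => /andP[Bv _]; rewrite mulf_neq0.
Qed.

(** The isotropic part of [perp u'] is stable under translation by [u'], and along this direction
    [B u] has the nonzero slope [B u u']. *)
Lemma card_isotropic_perp_nonorth u u' : u' \in isotropic -> B u u' != 0 ->
  #|isotropic :&: perp u'| = (#|isotropic :&: (perp u :&: perp u')| * #|F|)%N.
Proof.
move=> isou' Buu'; have Bu : B u' u' = 0 by move: isou'; rewrite inE => /eqP.
rewrite (@card_slice F V _ u' (B u) (fun=> B u u')) //.
- congr (#|pred_of_set _| * _)%N; apply/setP=> v; rewrite !inE.
  by rewrite -andbA; congr (_ && _); rewrite andbC.
- move=> v t; rewrite !inE form_shift // BD BZ Bu mulr0 addr0.
  by case/andP=> /eqP-> /eqP->; rewrite !mulr0 addr0 eqxx.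
- by move=> v t _; rewrite BD BZ.
Qed.

(** * Second moments of the orthogonality relation *)

Section Spectral.

Variable R : realFieldType.
Local Notation q := (#|F|%:R : R).
Local Notation N := (#|V|%:R : R).

Definition ortho_kernel (u v : V) : R := q * (B u v == 0)%:R - 1.
Local Notation e := ortho_kernel.

Lemma card_field_gt1 : 1 < q.
Proof. by rewrite ltr1n finNzRing_gt1. Qed.

Lemma sum_ortho_kernelM (D : {set V}) u u' :
  \sum_(v in D) e u v * e u' v =
    q ^+ 2 * #|D :&: (perp u :&: perp u')|%:R - q * #|D :&: perp u|%:R
      - q * #|D :&: perp u'|%:R + #|D|%:R.
Proof.
have cardE (P : {set V}) : #|D :&: P|%:R = \sum_(v in D) (v \in P)%:R :> R.
  rewrite -sum1_card natr_sum (eq_bigl (fun v => (v \in D) && (v \in P))).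
    by rewrite big_mkcondr; apply: eq_bigr => v _; case: (v \in P).
  by move=> v; rewrite inE.
rewrite !cardE -sum1_card natr_sum !mulr_sumr -!sumrB -big_split /=.
apply: eq_bigr => v _; rewrite /e !inE.
by case: (B u v == 0); case: (B u' v == 0) => /=; ring.
Qed.

Lemma perpZ t u : t != 0 -> perp (t *: u) = perp u.
Proof. by move=> t0; apply/setP=> v; rewrite !inE BC BZ mulf_eq0 (negPf t0) BC. Qed.

Lemma collinear_neq0 u v : u != 0 -> collinear u v ->
  exists2 t, t != 0 & u = t *: v.
Proof.
move=> u0 /existsP[t /eqP uE]; exists t => //.
by apply: contraNneq u0 => t0; rewrite uE t0 scale0r.
Qed.

Lemma card_perpR u : u != 0 -> #|perp u|%:R = N / q.
Proof.
move=> u0; have q0 : q != 0 by rewrite gt_eqF // (lt_trans ltr01 card_field_gt1).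
by apply: (mulIf q0); rewrite divfK // -natrM -card_perp.
Qed.

(** Two noncollinear hyperplanes meet in [N / q ^ 2] vectors, exactly the independent value, so
    their covariance vanishes; collinear vectors have the same hyperplane. *)
Lemma gram_setT u u' : u != 0 -> u' != 0 ->
  \sum_v e u v * e u' v = N * (q - 1) * (collinear u u')%:R.
Proof.
move=> u0 u'0; have q0 : q != 0 by rewrite gt_eqF // (lt_trans ltr01 card_field_gt1).
rewrite (eq_bigl (fun v => v \in [set: V])) => [|v]; last by rewrite inE.
rewrite sum_ortho_kernelM !setTI cardsT !card_perpR //.
have [col|ncol] := boolP (collinear u u').
  have [t t0 uE] := collinear_neq0 u0 col.
  by rewrite uE perpZ // setIid card_perpR //=; field.
have := congr1 (fun n => n%:R : R) (card_perpI u'0 ncol).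
rewrite natrM card_perpR // => pE.
have -> : #|perp u :&: perp u'|%:R = N / q / q :> R by rewrite pE mulfK.
by rewrite /=; field.
Qed.

(* Positive exactly for elliptic forms. *)
Definition isotropic_defect : R := N / q - #|isotropic|%:R.
Local Notation Delta := isotropic_defect.

(** Restricting [v] to the cone adds a multiple of the kernel itself. The result is a quadratic
    relation for the kernel, in which the sign of [Delta] decides whether the positive or the
    negative eigenvalues are the small ones. *)
Lemma gram_isotropic u u' : u != 0 -> u' != 0 ->
  u \in isotropic -> u' \in isotropic ->
  \sum_(v in isotropic) e u v * e u' v =
    (q - 1) * (N / q * (collinear u u')%:R - Delta * e u u').
Proof.
move=> u0 u'0 isou isou'.
have q0 : q != 0 by rewrite gt_eqF // (lt_trans ltr01 card_field_gt1).
(* Slicing along [w] leaves [(N - N / q) / q] isotropic vectors off [perp w]; they are subtracted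
   from the total [N / q - Delta]. *)
have isoperp w : w != 0 -> w \in isotropic ->
    #|isotropic :&: perp w|%:R = N / q / q - Delta.
  move=> w0 isow.
  have /(congr1 (fun n => n%:R : R)) :=
    @card_isotropicD_perp [set: V] w isow (fun v t _ => in_setT _).
  have /(congr1 (fun n => n%:R : R)) := cardsID (perp w) [set: V].
  have /(congr1 (fun n => n%:R : R)) := cardsID (perp w) isotropic.
  rewrite setIT setTI cardsT natrM !natrD card_perpR // /Delta => <- E1 E2.
  have -> : #|isotropic :\: perp w|%:R = (N - N / q) / q :> R.
    by rewrite -{1}E1 addrC addKr E2 mulfK.
  by field.
rewrite sum_ortho_kernelM !isoperp //.
have Biso w : w \in isotropic -> B w w = 0 by rewrite inE => /eqP.
have [col|ncol] := boolP (collinear u u').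
  have [t t0 uE] := collinear_neq0 u0 col.
  rewrite uE perpZ // setIid isoperp // /e BC BZ Biso // mulr0 eqxx /Delta /=.
  by field.
(* A nonorthogonal pair is handled by slicing along [u']. For an orthogonal pair [perp u'] is stable
   under translation by [u], so its isotropic vectors off [perp u] are counted by slicing along
   [u]. *)
have [orth|northo] := eqVneq (B u u') 0; last first.
  have /(congr1 (fun n => n%:R : R)) := card_isotropic_perp_nonorth isou' northo.
  rewrite natrM isoperp // => E.
  have -> : #|isotropic :&: (perp u :&: perp u')|%:R = (N / q / q - Delta) / q :> R.
    by rewrite E mulfK.
  by rewrite /e (negPf northo) /Delta /=; field.
have clU v t : v \in perp u' -> v + t *: u \in perp u'.
  by rewrite !inE BD BZ (BC u' u) orth mulr0 addr0.
have /(congr1 (fun n => n%:R : R)) := card_isotropicD_perp isou clU.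
have /(congr1 (fun n => n%:R : R)) := cardsID (perp u) (perp u').
have /(congr1 (fun n => n%:R : R)) := cardsID (perp u) (isotropic :&: perp u').
have /(congr1 (fun n => n%:R : R)) := card_perpI u'0 ncol.
rewrite -setIA (setIC (perp u')) !natrM !natrD card_perpR // isoperp //.
rewrite /e orth eqxx /=.
set K2 := #|isotropic :&: _|%:R; set K3 := #|isotropic :&: _ :\: _|%:R.
set p2 := #|perp u :&: _|%:R; set p3 := #|_|%:R => pE K3E p3E p3K.
have p2E : p2 = N / q / q by rewrite pE mulfK.
have K3E' : K3 = (N / q - p2) / q by rewrite -p3E addrC addKr p3K mulfK.
have -> : K2 = N / q / q - Delta - K3 by rewrite -K3E addrK.
rewrite K3E' p2E /Delta; by field.
Qed.

(* The difference of the two sides is, up to a positive factor, the sum over the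
   isotropic v of (sum_i p_i e(x_i, v))^2. *)
Lemma isotropic_form_bound (I : finType) (x : I -> V) (p : I -> R) :
  (forall i, p i != 0 -> (x i != 0) && (x i \in isotropic)) ->
  Delta * (\sum_i \sum_j p i * p j * e (x i) (x j)) <=
    N / q * \sum_i \sum_j p i * p j * (collinear (x i) (x j))%:R.
Proof.
move=> supp; have q1 := card_field_gt1.
rewrite -subr_ge0 -(pmulr_rge0 _ (_ : 0 < q - 1)) ?subr_gt0 //.
have -> : (q - 1) * (N / q * (\sum_i \sum_j p i * p j * (collinear (x i) (x j))%:R)
    - Delta * (\sum_i \sum_j p i * p j * e (x i) (x j)))
    = \sum_(v in isotropic) (\sum_i p i * e (x i) v) ^+ 2.
  transitivity (\sum_(v in isotropic) \sum_i \sum_j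
      p i * p j * (e (x i) v * e (x j) v)).
    rewrite [RHS]exchange_big /= !mulr_sumr -sumrB mulr_sumr; apply: eq_bigr => i _.
    rewrite [RHS]exchange_big /= !mulr_sumr -sumrB mulr_sumr; apply: eq_bigr => j _.
    rewrite -mulr_sumr.
    have [->|/supp/andP[xi0 isoi]] := eqVneq (p i) 0; first by ring.
    have [->|/supp/andP[xj0 isoj]] := eqVneq (p j) 0; first by ring.
    by rewrite gram_isotropic //; ring.
  apply: eq_bigr => v _; rewrite expr2 big_distrlr /=.
  by apply: eq_bigr => i _; apply: eq_bigr => j _; ring.
by apply: sumr_ge0 => v _; rewrite sqr_ge0.
Qed.

(* Each line of X contributes |F| - 1 equal terms to the sum of S v ^+ 2 over V. *)
Lemma orthogonal_pairs_bound (X : {set V}) (l : R) :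
  0 \notin X -> {in X &, forall x y, collinear x y -> x = y} ->
  0 < l -> l ^+ 2 = N ->
  \sum_(x in X) \sum_(y in X) e x y <= #|X|%:R * l.
Proof.
move=> X0 Xcol l0 lN; have q1 := card_field_gt1.
pose S v := \sum_(x in X) e x v.
have Xn0 x : x \in X -> x != 0 by move=> Xx; apply: contraNneq X0 => <-.
have sumS : \sum_v S v ^+ 2 = N * (q - 1) * #|X|%:R.
  transitivity (\sum_v \sum_(x in X) \sum_(y in X) e x v * e y v).
    by apply: eq_bigr => v _; rewrite expr2 big_distrlr.
  rewrite exchange_big -sum1_card natr_sum mulr_sumr /=; apply: eq_bigr => x Xx.
  rewrite exchange_big (bigD1 x) //= gram_setT ?Xn0 // big1 => [|y /andP[Xy yx]].
    rewrite addr0; congr (_ * _%:R); apply/eqP; rewrite eqb1.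
    by apply/existsP; exists 1; rewrite scale1r.
  rewrite gram_setT ?Xn0 //; case: (boolP (collinear x y)) => [/Xcol|_].
    by move/(_ Xx Xy)/eqP; rewrite eq_sym (negPf yx).
  by rewrite mulr0.
have SZ t v : t != 0 -> S (t *: v) = S v.
  by move=> t0; apply: eq_bigr => x _; rewrite /e BZ mulf_eq0 (negPf t0).
have sumSX : (q - 1) * (\sum_(y in X) S y ^+ 2) <= N * (q - 1) * #|X|%:R.
  rewrite -sumS.
  have -> : (q - 1) * (\sum_(y in X) S y ^+ 2) =
      \sum_(p in setX [set~ (0 : F)] X) S (p.1 *: p.2) ^+ 2.
    rewrite (eq_bigl (fun p => (p.1 \in [set~ 0]) && (p.2 \in X))) => [|p]; last first.
      by rewrite !inE.
    rewrite -(pair_big (mem [set~ (0 : F)]) (mem X) (fun t y => S (t *: y) ^+ 2)) /=.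
    transitivity (\sum_(t in [set~ (0 : F)]) \sum_(y in X) S y ^+ 2); last first.
      apply: eq_bigr => t; rewrite in_setC1 => t0.
      by apply: eq_bigr => y _; rewrite SZ.
    rewrite sumr_const cardsC1 -[RHS]mulr_natl; congr (_ * _).
    by rewrite -subn1 natrB //; apply: ltnW; exact: finNzRing_gt1.
  (* Scaling is injective on nonzero scalars times [X], since [X] has at most one vector on each
     line; the sum is thus a part of the sum over [V]. *)
  rewrite -(big_imset (fun v => S v ^+ 2)) /=; last first.
    move=> [t x] [t' x'] /setXP[t0 Xx] /setXP[t'0 Xx'] /= E.
    move: t0 t'0; rewrite /= !in_setC1 => t0 t'0.
    have xx' : x = x'.
      apply: Xcol => //; apply/existsP; exists (t^-1 * t').
      by rewrite -scalerA -E scalerA mulVf // scale1r.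
    congr (_, _) => //; move: E; rewrite -xx' => /eqP.
    by rewrite -subr_eq0 -scalerBl scaler_eq0 (negPf (Xn0 _ Xx)) orbF subr_eq0 => /eqP.
  set I := imset _ _; rewrite [X in _ <= X](bigID (mem I)) /=.
  by rewrite lerDl; apply: sumr_ge0 => v _; rewrite sqr_ge0.
have {}sumSX : \sum_(y in X) S y ^+ 2 <= l ^+ 2 * #|X|%:R.
  by rewrite -(ler_pM2l (_ : 0 < q - 1)) ?subr_gt0 // lN mulrA (mulrC (q - 1) N).
(* The pointwise inequality [2 * S y <= S y ^+ 2 / l + l] takes the place of Cauchy-Schwarz. *)
rewrite exchange_big -/S; apply: (@le_trans _ _ (\sum_(y in X) (S y ^+ 2 / l + l) / 2)).
  apply: ler_sum => y _; rewrite -subr_ge0.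
  have -> : (S y ^+ 2 / l + l) / 2 - S y = (S y - l) ^+ 2 / (2 * l).
    by field; rewrite gt_eqF.
  by rewrite divr_ge0 ?sqr_ge0 // mulr_ge0 // ltW.
rewrite -mulr_suml big_split /= -mulr_suml sumr_const -mulr_natl.
have le : (\sum_(y in X) S y ^+ 2) / l <= #|X|%:R * l.
  by rewrite ler_pdivrMr // -mulrA -expr2 mulrC.
by lra.
Qed.

End Spectral.
End OrthogonalGeometry.

(** * Zeros of sums of squares *)

Section ZeroCount.

Variable F : finFieldType.
Local Notation q := (#|F|%:Z).

(** The deviation from equidistribution of the zeros, positive when there are fewer than average. It
    is scaled by [q] to stay an integer, and adjoining a hyperbolic plane simply multiplies it by
    [q]. *)
Definition zero_defect (T : finType) (phi : T -> F) : int :=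
  #|T|%:Z - q * #|[set w | phi w == 0]|%:Z.

Lemma zero_defect_bij (T T' : finType) (f : T -> T') phi phi' :
  bijective f -> (forall w, phi' (f w) = phi w) ->
  zero_defect phi = zero_defect phi'.
Proof.
move=> bf phiE; rewrite /zero_defect (bij_eq_card bf).
have -> : [set w | phi' w == 0] = f @: [set w | phi w == 0].
  have [f' fK f'K] := bf.
  apply/setP=> w; apply/idP/imsetP => [|[z]]; rewrite inE.
    by move=> p0; exists (f' w); rewrite ?inE ?f'K // -phiE f'K.
  by move=> p0 ->; rewrite inE phiE.
by rewrite card_imset //; exact: bij_inj.
Qed.

(** On the diagonal the plane contributes nothing, which gives [q] copies of the zeros of [phi]. Off
    it, the nonzero difference of the two coordinates and the point of [T] determine the zero,
    whatever the value of [phi]. *)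
Lemma zero_defect_hyperbolic (T : finType) (phi : T -> F) :
  (2%:R : F) != 0 ->
  zero_defect (fun p : F * F * T => p.1.1 ^+ 2 - p.1.2 ^+ 2 + phi p.2)
    = q * zero_defect phi.
Proof.
move=> two0; rewrite /zero_defect !card_prod.
set Z := [set p | _]; set Z0 := [set w | _].
pose D := [set p : F * F * T | p.1.1 == p.1.2].
have card_diag : #|Z :&: D| = (#|F| * #|Z0|)%N.
  have -> : Z :&: D = [set ((p.1, p.1), p.2) | p in setX [set: F] Z0].
    apply/setP=> -[[x y] w]; apply/idP/imsetP => [|[[a b] /=]].
      rewrite !inE /= => /andP[z0 /eqP xy]; exists (x, w); rewrite ?xy //=.
      by move: z0; rewrite xy subrr add0r !inE.
    by rewrite !inE /= => z0 [-> -> ->]; rewrite subrr add0r eqxx z0.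
  rewrite card_in_imset ?cardsX ?cardsT // => -[x w] [x' w'] _ _ /=.
  by move=> [-> _ ->].
have card_ndiag : #|Z :\: D| = (#|F|.-1 * #|T|)%N.
  (* With [a] the difference of the two coordinates, this solves [a * (2 * x - a) = - phi w] for the
     first one. *)
  pose x (p : F * T) := (p.1 - phi p.2 / p.1) / 2%:R.
  have -> : Z :\: D = [set ((x p, x p - p.1), p.2) | p in setX [set~ 0] [set: T]].
    apply/setP=> -[[u v] w]; apply/idP/imsetP => [|[[a b] /=]].
      rewrite !inE /= => /andP[uv /eqP z0]; rewrite -subr_eq0 in uv.
      exists (u - v, w); rewrite ?inE ?uv //=.
      have -> : x (u - v, w) = u.
        rewrite /x /=; have -> : phi w = - (u ^+ 2 - v ^+ 2).
          by apply/eqP; rewrite -addr_eq0 addrC z0.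
        by field; rewrite two0.
      by congr (_, _, _); ring.
    rewrite !inE /= andbT => a0 [-> -> ->]; apply/andP; split.
      by rewrite -subr_eq0 opprB addrC subrK.
    by apply/eqP; rewrite /x /=; field; rewrite two0.
  rewrite card_in_imset ?cardsX ?cardsT ?cardsC1 // => -[a w] [a' w'] _ _ /=.
  by move=> [-> /addrI /oppr_inj -> ->].
rewrite -(cardsID D Z) card_diag card_ndiag.
case: #|F| (finNzRing_gt1 F) => // n _.
by rewrite /= PoszD !PoszM intS; ring.
Qed.

Definition plus_square (T : finType) (psi : T -> F) (p : F * T) := p.1 ^+ 2 + psi p.2.

(** Replacing [y] by [i * y] turns the sum of two squares into a hyperbolic plane. *)
Lemma zero_defect_two_squares (T : finType) (psi : T -> F) (i : F) :
  (2%:R : F) != 0 -> i ^+ 2 = -1 ->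
  zero_defect (plus_square (plus_square psi)) = q * zero_defect psi.
Proof.
move=> two0 i2; rewrite -zero_defect_hyperbolic //.
apply: (@zero_defect_bij _ _ (fun p : F * (F * T) => ((p.1, i * p.2.1), p.2.2))).
  exists (fun p => (p.1.1, (- i * p.1.2, p.2))) => [[x [y w]]|[[x y] w]] /=.
    by congr (_, (_, _)); rewrite mulrA mulNr -expr2 i2 opprK mul1r.
  by congr (_, _, _); rewrite mulrA mulrN -expr2 i2 opprK mul1r.
by move=> [x [y w]]; rewrite /plus_square /= exprMn i2 mulN1r opprK addrA.
Qed.

(* With a^2 + b^2 = -1, the sum x1^2 + x2^2 + x3^2 + x4^2 equals
   x1^2 - (a x3 + b x4)^2 + x2^2 - (b x3 - a x4)^2. *)
Lemma zero_defect_four_squares (T : finType) (psi : T -> F) (a b : F) :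
  (2%:R : F) != 0 -> a ^+ 2 + b ^+ 2 = -1 ->
  zero_defect (plus_square (plus_square (plus_square (plus_square psi))))
    = q ^+ 2 * zero_defect psi.
Proof.
move=> two0 ab; rewrite expr2 -mulrA -!zero_defect_hyperbolic //.
have b2 : b ^+ 2 = -1 - a ^+ 2 by rewrite -ab; ring.
apply: (@zero_defect_bij _ _ (fun p : F * (F * (F * (F * T))) =>
  let: (x1, (x2, (x3, (x4, w)))) := p in
  ((x1, a * x3 + b * x4), ((x2, b * x3 - a * x4), w)))).
  exists (fun p => let: ((x, y), ((z, u), w)) := p in
    (x, (z, (- (a * y + b * u), (- (b * y - a * u), w))))).
    move=> [x1 [x2 [x3 [x4 w]]]] /=.
    by congr (_, (_, (_, (_, _)))); ring: b2.
  move=> [[x y] [[z u] w]] /=.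
  by congr (_, _, (_, _, _)); ring: b2.
by move=> [x1 [x2 [x3 [x4 w]]]]; rewrite /plus_square /=; ring: b2.
Qed.

Definition plus_sum_squares n (T : finType) (psi : T -> F) (p : 'rV[F]_n * T) :=
  \sum_(i < n) p.1 0 i ^+ 2 + psi p.2.

Lemma zero_defect_sum0 (T : finType) (psi : T -> F) :
  zero_defect (@plus_sum_squares 0 T psi) = zero_defect psi.
Proof.
apply: (@zero_defect_bij _ _ (fun p : 'rV[F]_0 * T => p.2)).
  exists (fun w => (0, w)) => [[v w]|//] /=.
  by congr (_, _); apply/rowP => -[].
by move=> [v w]; rewrite /plus_sum_squares big_ord0 add0r.
Qed.

Lemma zero_defect_sumS n (T : finType) (psi : T -> F) :
  zero_defect (@plus_sum_squares n.+1 T psi)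
    = zero_defect (@plus_sum_squares n (F * T)%type (plus_square psi)).
Proof.
apply: (@zero_defect_bij _ _ (fun p : 'rV[F]_(1 + n) * T =>
  (rsubmx p.1, ((lsubmx p.1) 0 0, p.2)))).
  exists (fun p => (row_mx p.2.1%:M p.1, p.2.2)) => [[v w]|[v [x w]]] /=.
    by rewrite -mx11_scalar hsubmxK.
  by rewrite row_mxKr row_mxKl mxE eqxx.
move=> [v w]; rewrite /plus_sum_squares /plus_square /=.
rewrite (@big_split_ord _ _ _ 1 n) big_ord1 /= addrA (addrC (_ ^+ 2)).
rewrite [lsubmx _ _ _]mxE; congr (_ + _ + _).
by apply: eq_bigr => j _; rewrite mxE.
Qed.

Lemma zero_defect_sum_pm1 (i : F) m (T : finType) (psi : T -> F) :
  (2%:R : F) != 0 -> i ^+ 2 = -1 ->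
  zero_defect (@plus_sum_squares (2 * m) T psi) = q ^+ m * zero_defect psi.
Proof.
move=> two0 i2; elim: m T psi => [|m IH] T psi.
  by rewrite mul1r zero_defect_sum0.
have -> : (2 * m.+1 = (2 * m).+2)%N by lia.
by rewrite !zero_defect_sumS IH (zero_defect_two_squares _ two0 i2) exprSr mulrA.
Qed.

(** A square root of -1 may be missing, whereas -1 is a sum of two squares in every field considered
    here; the squares are therefore removed in blocks of four. *)
Lemma zero_defect_sum_mul4 (a b : F) m (T : finType) (psi : T -> F) :
  (2%:R : F) != 0 -> a ^+ 2 + b ^+ 2 = -1 ->
  zero_defect (@plus_sum_squares (4 * m) T psi) = q ^+ (2 * m) * zero_defect psi.
Proof.
move=> two0 ab; elim: m T psi => [|m IH] T psi.
  by rewrite mul1r zero_defect_sum0.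
have -> : (4 * m.+1 = (4 * m).+4)%N by lia.
rewrite !zero_defect_sumS IH (zero_defect_four_squares _ two0 ab) mulrA -exprD.
by congr (_ ^+ _ * _); lia.
Qed.

(** As [g] is a nonsquare, the origin is the only zero of this binary form. This is the source of
    the positive sign of the defect. *)
Lemma zero_defect_anisotropic (g : F) : (forall s, s ^+ 2 != g) ->
  zero_defect (plus_square (fun s : F => - (g * s ^+ 2))) = q ^+ 2 - q.
Proof.
move=> gns; rewrite /zero_defect card_prod.
have -> : [set w | plus_square (fun s => - (g * s ^+ 2)) w == 0] = [set (0, 0)].
  apply/setP=> -[x s]; rewrite !inE /plus_square /= xpair_eqE subr_eq0.
  have [->|s0] := eqVneq s 0; first by rewrite expr0n mulr0 sqrf_eq0 andbT.
  rewrite andbF; apply/negP => /eqP xs; have /eqP := gns (x / s); apply.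
  by rewrite expr_div_n xs mulfK // sqrf_eq0.
by rewrite cards1 PoszM; ring.
Qed.

End ZeroCount.

(** * Squares and nonsquares in a field with a primitive element *)

Lemma card_halfE (F : finFieldType) : odd #|F| -> (#|F| = (2 * #|F|.-1./2).+1)%N.
Proof.
rewrite mul2n; case: #|F| (finNzRing_gt1 F) => //= n _ /negPf nodd.
by rewrite -{1}(odd_double_half n) nodd.
Qed.

Section PrimitiveRadius.

Variables (F : finFieldType) (g : F) (h : nat).
Hypothesis cardF : (#|F| = (2 * h).+1)%N.
Hypothesis prim_g : (#|F|.-1).-primitive_root g.

Lemma prim_half_gt0 : (0 < h)%N.
Proof. by have := finNzRing_gt1 F; rewrite cardF; lia. Qed.

Lemma prim_half_neq1 : g ^+ h != 1.
Proof.
rewrite -(prim_order_dvd prim_g) cardF /=; apply/negP => /dvdn_leq.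
by have := prim_half_gt0; lia.
Qed.

Lemma prim_half : g ^+ h = -1.
Proof.
have /eqP : (g ^+ h) ^+ 2 = 1.
  by rewrite -exprM mulnC; have := prim_expr_order prim_g; rewrite cardF.
by rewrite sqrf_eq1 (negPf prim_half_neq1) => /eqP.
Qed.

Lemma odd_card_two_neq0 : (2%:R : F) != 0.
Proof.
have := prim_half_neq1; rewrite prim_half; apply: contraNneq => two0.
by rewrite eq_sym -addr_eq0 -two0.
Qed.

Lemma prim_neq0 : g != 0.
Proof.
apply: contraNneq (oner_neq0 F) => g0.
have := prim_half; rewrite g0 expr0n gtn_eqF ?prim_half_gt0 // => /eqP.
by rewrite eq_sym oppr_eq0.
Qed.

(** Euler's criterion: a square has [h]-th power 1, while [g ^+ h] is -1. *)
Lemma prim_nonsquare s : s ^+ 2 != g.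
Proof.
apply/negP => /eqP sg; have s0 : s != 0.
  by apply: contraNneq prim_neq0 => s0; rewrite -sg s0 expr0n.
have := prim_half_neq1; rewrite -sg -exprM; apply/negP; rewrite negbK.
have := expf_card s; rewrite cardF exprSr => /(canRL (mulfK s0)) ->.
by rewrite divff.
Qed.

Lemma sqrt_opp1 : (#|F| %% 4 = 1)%N -> exists i : F, i ^+ 2 = -1.
Proof.
move=> q4; exists (g ^+ h./2); rewrite -prim_half -exprM; congr (_ ^+ _).
by move: q4; rewrite cardF; lia.
Qed.

(** Pigeonhole: the set of [h + 1] squares and its image under [x -> -1 - x] cannot be disjoint in a
    field of [2 * h + 1] elements. *)
Lemma sum_two_squares_opp1 : exists a b : F, a ^+ 2 + b ^+ 2 = -1.
Proof.
(* Zero, placed at the index [h], and one element from each pair of opposite nonzero elements: the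
   squares of these are distinct. *)
pose f (i : 'I_h.+1) := if i == h :> nat then 0 else g ^+ i.
have g0 n : g ^+ n != 0 by rewrite expf_neq0 // prim_neq0.
have f_inj : injective (fun i => f i ^+ 2).
  move=> i j /eqP; rewrite /f.
  case: (eqVneq (i : nat) h) => ih; case: (eqVneq (j : nat) h) => jh.
  - by move=> _; apply: val_inj; rewrite /= ih jh.
  - by rewrite expr0n eq_sym sqrf_eq0 (negPf (g0 _)).
  - by rewrite expr0n sqrf_eq0 (negPf (g0 _)).
  have := ltn_ord i; have := ltn_ord j => jlt ilt.
  rewrite -!exprM (eq_prim_root_expr prim_g) cardF /= !modn_small; [|lia..].
  by move=> /eqP ij; apply: val_inj => /=; lia.
pose S := [set f i ^+ 2 | i : 'I_h.+1]; pose S' := [set -1 - x | x in S].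
have cS : #|S| = h.+1 by rewrite card_imset // card_ord.
have cS' : #|S'| = h.+1 by rewrite card_imset // => x y /addrI /oppr_inj.
have : (0 < #|S :&: S'|)%N.
  have := cardsUI S S'; have := subset_leq_card (subsetT (S :|: S')).
  by rewrite cardsT cS cS' cardF; lia.
rewrite card_gt0 => /set0Pn[x /setIP[/imsetP[i _ xi] /imsetP[y /imsetP[j _ ->] xj]]].
by exists (f i), (f j); rewrite -xi xj subrK.
Qed.

End PrimitiveRadius.

(** One square is kept to form an anisotropic plane with [- (g * s ^+ 2)]; the other [2 * m] split
    into hyperbolic planes. For [d = 4 * k - 1] their number is not a multiple of four, so
    [#|F| %% 4 = 1] is used to get a root of -1. *)
Lemma zero_defect_cone (F : finFieldType) (g : F) (m k : nat) :
  odd #|F| -> (#|F|.-1).-primitive_root g -> (0 < k)%N ->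
  ((2 * m).+1 = 4 * k - 1 /\ #|F| %% 4 = 1)%N \/ ((2 * m).+1 = 4 * k + 1)%N ->
  zero_defect (plus_sum_squares (n := (2 * m).+1) (fun s : F => - (g * s ^+ 2)))
    = #|F|%:Z ^+ m * (#|F|%:Z ^+ 2 - #|F|%:Z).
Proof.
move=> oddF prim_g k0 dE.
have {}oddF := card_halfE oddF.
have two0 := odd_card_two_neq0 oddF prim_g.
rewrite zero_defect_sumS -(zero_defect_anisotropic (prim_nonsquare oddF prim_g)).
case: dE => [[_ /(sqrt_opp1 oddF prim_g)[i i2]]|dE].
  exact: zero_defect_sum_pm1 two0 i2.
have [a [b ab]] := sum_two_squares_opp1 oddF prim_g.
have -> : (2 * m = 4 * k)%N by lia.
have -> : (m = 2 * k)%N by lia.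
exact: zero_defect_sum_mul4 two0 ab.
Qed.

(** * The cone over the sphere *)

Section DotProduct.

Variables (F : finFieldType) (d : nat) (g : F).

Definition dot (x y : 'rV[F]_d) : F := \sum_(i < d) x 0 i * y 0 i.

Lemma dotC x y : dot x y = dot y x.
Proof. by apply: eq_bigr => i _; rewrite mulrC. Qed.

Lemma dotDr x y z : dot x (y + z) = dot x y + dot x z.
Proof. by rewrite -big_split; apply: eq_bigr => i _; rewrite mxE mulrDr. Qed.

Lemma dotDl x y z : dot (y + z) x = dot y x + dot z x.
Proof. by rewrite dotC dotDr !(dotC x). Qed.

Lemma dotZr x t y : dot x (t *: y) = t * dot x y.
Proof. by rewrite /dot mulr_sumr; apply: eq_bigr => i _; rewrite mxE mulrCA. Qed.

Lemma dotNr x y : dot x (- y) = - dot x y.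
Proof. by rewrite -scaleN1r dotZr mulN1r. Qed.

Lemma dotBr x y z : dot x (y - z) = dot x y - dot x z.
Proof. by rewrite dotDr dotNr. Qed.

Lemma dotBl x y z : dot (y - z) x = dot y x - dot z x.
Proof. by rewrite dotC dotBr !(dotC x). Qed.

Lemma dot0r x : dot x 0 = 0.
Proof. by rewrite -(scale0r 0) dotZr mul0r. Qed.

Lemma dot_nondeg x : (forall y, dot x y = 0) -> x = 0.
Proof.
move=> x0; apply/rowP => i; rewrite mxE -[RHS](x0 (delta_mx 0 i)) /dot.
rewrite (bigD1 i) //= mxE !eqxx mulr1 big1 ?addr0 // => j ji.
by rewrite mxE (negPf ji) andbF mulr0.
Qed.

Lemma in_sphere x : (x \in sphere d g) = (dot x x == g).
Proof. by rewrite inE; congr (_ == _); apply: eq_bigr => i _; rewrite expr2. Qed.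

(** The polar form of [x.x - g s^2]. The dimension is written [d + 1] so that the last coordinate is
    a block of the row. *)
Definition cone_form (u v : 'rV[F]_(d + 1)) : F :=
  dot (lsubmx u) (lsubmx v) - g * (rsubmx u 0 0 * rsubmx v 0 0).

Lemma cone_form_row x s y t :
  cone_form (row_mx x s%:M) (row_mx y t%:M) = dot x y - g * (s * t).
Proof. by rewrite /cone_form !row_mxKl !row_mxKr !mxE !eqxx. Qed.

Lemma cone_formC u v : cone_form u v = cone_form v u.
Proof. by rewrite /cone_form dotC (mulrC (rsubmx u 0 0)). Qed.

Lemma cone_formDr u v w : cone_form u (v + w) = cone_form u v + cone_form u w.
Proof. by rewrite /cone_form !linearD /= dotDr !mxE; ring. Qed.

Lemma cone_formZr u t v : cone_form u (t *: v) = t * cone_form u v.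
Proof. by rewrite /cone_form !linearZ /= dotZr !mxE; ring. Qed.

Lemma cone_form_nondeg u : g != 0 -> (forall v, cone_form u v = 0) -> u = 0.
Proof.
move=> g0; rewrite -(hsubmxK u) (mx11_scalar (rsubmx u)).
set x := lsubmx u; set s := rsubmx u 0 0 => u0.
have s0 : s = 0.
  have := u0 (row_mx 0 1%:M); rewrite cone_form_row dot0r sub0r mulr1 => /eqP.
  by rewrite oppr_eq0 mulf_eq0 (negPf g0) => /eqP.
rewrite s0 in u0 *; have -> : x = 0.
  apply: dot_nondeg => y; have := u0 (row_mx y 0%:M).
  by rewrite cone_form_row mul0r mulr0 subr0.
by rewrite raddf0 row_mx0.
Qed.

Lemma card_cone :
  #|isotropic cone_form| =
    #|[set p | plus_sum_squares (n := d) (fun s : F => - (g * s ^+ 2)) p == 0]|.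
Proof.
pose f (p : 'rV[F]_d * F) : 'rV[F]_(d + 1) := row_mx p.1 p.2%:M.
have f_inj : injective f.
  move=> [x s] [y t] /eq_row_mx[/= -> /matrixP/(_ 0 0)].
  by rewrite !mxE !mulr1n => ->.
have fE p : cone_form (f p) (f p) = plus_sum_squares (fun s : F => - (g * s ^+ 2)) p.
  by rewrite cone_form_row /plus_sum_squares expr2.
rewrite -(card_imset _ f_inj); congr #|pred_of_set _|.
apply/setP=> u; apply/idP/imsetP => [|[p]]; rewrite inE.
  have -> : u = f (lsubmx u, rsubmx u 0 0).
    by rewrite /f /= -mx11_scalar hsubmxK.
  by move=> u0; exists (lsubmx u, rsubmx u 0 0); rewrite // inE -fE.
by rewrite -fE => p0 ->; rewrite inE.
Qed.

End DotProduct.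

(** * The one-sided bound on the elliptic cone *)

Section ConeBound.

Variables (R : realFieldType) (F : finFieldType) (g : F) (m k : nat).
Local Notation d := (2 * m).+1.
Local Notation V := 'rV[F]_d.
Local Notation q := (#|F|%:R : R).
Hypothesis oddF : odd #|F|.
Hypothesis prim_g : (#|F|.-1).-primitive_root g.
Hypothesis k_gt0 : (0 < k)%N.
Hypothesis dE : (d = 4 * k - 1 /\ #|F| %% 4 = 1)%N \/ (d = 4 * k + 1)%N.

Local Notation K := (q ^+ m.+1 / (q - 1)).

(** This is [isotropic_form_bound] divided by the positive defect: [K] is [N / q] over
    [q ^+ m * (q - 1)], where [N = q ^+ (2 * m + 2)]. The square of the total weight comes from the
    constant -1 in the kernel. *)
Lemma cone_form_bound (I : finType) (x : I -> 'rV[F]_(d + 1)) (p : I -> R) :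
  (forall i, p i != 0 -> (x i != 0) && (x i \in isotropic (cone_form g))) ->
  q * (\sum_i \sum_j p i * p j * (cone_form g (x i) (x j) == 0)%:R) <=
    (\sum_i p i) ^+ 2 + K * (\sum_i \sum_j p i * p j * (collinear (x i) (x j))%:R).
Proof.
move=> supp; have q1 : 1 < q := card_field_gt1 F R.
have q0 : 0 < q by apply: lt_trans q1.
have qn0 : q != 0 by rewrite gt_eqF.
have two0 : (2%:R : F) != 0.
  exact: odd_card_two_neq0 (card_halfE oddF) prim_g.
have g0 : g != 0 by exact: prim_neq0 (card_halfE oddF) prim_g.
have := @isotropic_form_bound F _ (cone_form g) two0 (@cone_formC _ _ g)
  (@cone_formDr _ _ g) (@cone_formZr _ _ g) (fun u => cone_form_nondeg g0) R I x p supp.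
rewrite /isotropic_defect; set N := (X in (X / q - _) * _ <= _).
have NE : N = q ^+ m.+1 * q ^+ m.+1.
  transitivity (#|{: 'rV[F]_(d + 1)}|%:R : R); first by [].
  by rewrite card_mx mul1n natrX -exprD; congr (_ ^+ _); lia.
(* The isotropic defect is the zero defect of the cone divided by [q]. *)
have -> : N / q - #|isotropic (cone_form (d := d) g)|%:R = q ^+ m * (q - 1).
  have := congr1 (intr : int -> R) (zero_defect_cone oddF prim_g k_gt0 dE).
  rewrite /zero_defect -card_cone card_prod card_mx mul1n.
  rewrite rmorphB !rmorphM rmorphB rmorphM !rmorphXn /= -!pmulrn => E.
  rewrite NE; apply: (mulfI qn0); rewrite mulrBr.
  have -> : q * (q ^+ m * (q - 1)) = q ^+ m * (q * q - q) by ring.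
  rewrite -E mulrCA mulfV // mulr1; congr (_ - _).
  by rewrite -exprSr -exprD; congr (_ ^+ _); lia.
rewrite -/N NE; set D := (\sum_i \sum_j _ * (collinear _ _)%:R) => le.
have -> : q * (\sum_i \sum_j p i * p j * (cone_form g (x i) (x j) == 0)%:R)
   = (\sum_i p i) ^+ 2 +
     \sum_i \sum_j p i * p j * ortho_kernel (cone_form g) R (x i) (x j).
  rewrite expr2 big_distrlr /= -big_split mulr_sumr /=; apply: eq_bigr => i _.
  rewrite -big_split mulr_sumr /=; apply: eq_bigr => j _.
  by rewrite /ortho_kernel; ring.
rewrite lerD2l -(ler_pM2l (_ : 0 < q ^+ m * (q - 1))); last first.
  by rewrite mulr_gt0 ?exprn_gt0 // subr_gt0.
apply: le_trans le _; rewrite le_eqVlt; apply/orP; left; apply/eqP.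
rewrite exprS; field; rewrite qn0 subr_eq0.
by rewrite gt_eqF.
Qed.

End ConeBound.

(** * Energy of subsets of the sphere *)

Lemma sum_indicator2 (R : realFieldType) (I J : finType) (A : {set I}) (B : {set J})
    (s t : R) (f : I -> J -> R) :
  \sum_i \sum_j s * (i \in A)%:R * (t * (j \in B)%:R) * f i j
    = s * t * \sum_(i in A) \sum_(j in B) f i j.
Proof.
rewrite mulr_sumr [RHS]big_mkcond; apply: eq_bigr => i _ /=.
case: (i \in A); last by rewrite big1 // => j _; rewrite mulr0 !mul0r.
rewrite mulr_sumr [RHS]big_mkcond; apply: eq_bigr => j _ /=.
by case: (j \in B); rewrite ?mulr1 // !mulr0 mul0r.
Qed.

Lemma sum_indicator (R : realFieldType) (I : finType) (A : {set I}) :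
  \sum_i (i \in A)%:R = #|A|%:R :> R.
Proof.
rewrite -sum1_card natr_sum big_mkcond /=.
by rewrite [RHS]big_mkcond; apply: eq_bigr => i _; case: (i \in A).
Qed.

Section SphereEnergy.

Variables (R : realFieldType) (F : finFieldType) (g : F) (m k : nat).
Local Notation d := (2 * m).+1.
Local Notation V := 'rV[F]_d.
Local Notation q := (#|F|%:R : R).
Hypothesis oddF : odd #|F|.
Hypothesis prim_g : (#|F|.-1).-primitive_root g.
Hypothesis k_gt0 : (0 < k)%N.
Hypothesis dE : (d = 4 * k - 1 /\ #|F| %% 4 = 1)%N \/ (d = 4 * k + 1)%N.
Variable A : {set V}.
Hypothesis sA : A \subset sphere d g.

Local Notation K := (q ^+ m.+1 / (q - 1)).
Local Notation n := (#|A|%:R : R).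

(** Equal points are left out, so that every difference gives a nonzero vector of the cone. *)
Definition isotropic_pairs : {set V * V} :=
  [set z | [&& z.1 \in A, z.2 \in A, z.1 != z.2 &
    dot (z.1 - z.2) (z.1 - z.2) == 0]].
Local Notation D := isotropic_pairs.

(** These are corners at [z.2]: an isotropic chord [z.1 - z.2] of the sphere is orthogonal to [z.2],
    so the second side [a - z.2] may be replaced by [a]. *)
Definition isotropic_corners : R :=
  \sum_(a in A) \sum_(z in D) (dot a (z.1 - z.2) == 0)%:R.
Local Notation T := isotropic_corners.

Lemma two_neq0 : (2%:R : F) != 0.
Proof. exact: odd_card_two_neq0 (card_halfE oddF) prim_g. Qed.

Lemma dotA a : a \in A -> dot a a = g.
Proof. by move=> /(subsetP sA); rewrite in_sphere => /eqP. Qed.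

Lemma isotropic_pair_dot a c : a \in A -> c \in A ->
  (dot (a - c) (a - c) == 0) = (dot a c == g).
Proof.
move=> aA cA; rewrite dotBr !dotBl !dotA // (dotC c a).
have -> : g - dot a c - (dot a c - g) = 2%:R * (g - dot a c) by ring.
by rewrite mulf_eq0 (negPf two_neq0) subr_eq0 eq_sym.
Qed.

(** The cone bound is applied to the points [(a, 1)] with weight 1 and the isotropic differences
    [(a - c, 0)] with weight [s]; the cross terms produce [2 * s * T]. *)
Lemma corner_bound (s : R) : 0 <= s ->
  q * (\sum_(a in A) \sum_(b in A) (dot a b == g)%:R + 2 * s * T) <=
    (n + s * #|D|%:R) ^+ 2 + K * (n + s ^+ 2 *
      \sum_(z in D) \sum_(w in D) (collinear (z.1 - z.2) (w.1 - w.2))%:R).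
Proof.
move=> s0.
pose x (i : V + V * V) : 'rV[F]_(d + 1) := match i with
  | inl a => row_mx a 1%:M | inr z => row_mx (z.1 - z.2) 0%:M end.
pose p (i : V + V * V) : R := match i with
  | inl a => 1 * (a \in A)%:R | inr z => s * (z \in D)%:R end.
have supp i : p i != 0 -> (x i != 0) && (x i \in isotropic (cone_form g)).
  case: i => [a|z] /=; rewrite mulf_eq0 negb_or pnatr_eq0 eqb0 negbK.
    move=> /andP[_ aA]; rewrite inE cone_form_row dotA // !mulr1 subrr eqxx andbT.
    apply/eqP => /rowP/(_ (rshift d 0)); rewrite row_mxEr !mxE eqxx => /eqP.
    by rewrite (negPf (oner_neq0 F)).
  move=> /andP[_]; rewrite inE => /and4P[_ _ zz z0].
  rewrite inE cone_form_row mulr0 mulr0 subr0 z0 andbT.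
  apply/eqP => /(congr1 lsubmx)/eqP.
  by rewrite row_mxKl linear0 subr_eq0 (negPf zz).
have := cone_form_bound oddF prim_g k_gt0 dE supp.
have -> : \sum_i p i = n + s * #|D|%:R.
  rewrite big_sumType /=; congr (_ + _).
    by rewrite -(sum_indicator R); apply: eq_bigr => a _; rewrite mul1r.
  by rewrite -(sum_indicator R) mulr_sumr.
have split2 f : \sum_i \sum_j p i * p j * f (x i) (x j) =
    \sum_(a in A) \sum_(b in A) f (x (inl a)) (x (inl b))
    + s * \sum_(a in A) \sum_(z in D) f (x (inl a)) (x (inr z))
    + (s * \sum_(z in D) \sum_(a in A) f (x (inr z)) (x (inl a))
    + s ^+ 2 * \sum_(z in D) \sum_(w in D) f (x (inr z)) (x (inr w))).
  rewrite big_sumType /=; congr (_ + _).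
    under eq_bigr => a _ do rewrite big_sumType /=.
    rewrite big_split /=; congr (_ + _).
      by rewrite (sum_indicator2 _ _ 1 1) mulr1 mul1r.
    by rewrite (sum_indicator2 _ _ 1 s) mul1r.
  under eq_bigr => a _ do rewrite big_sumType /=.
  rewrite big_split /=; congr (_ + _).
    by rewrite (sum_indicator2 _ _ s 1) mulr1.
  by rewrite (sum_indicator2 _ _ s s) expr2.
rewrite (split2 (fun u v => (cone_form g u v == 0)%:R)).
rewrite (split2 (fun u v => (collinear u v)%:R)) => {split2} le.
have q1 : 1 < q := card_field_gt1 F R.
have q0 : 0 < q by apply: lt_trans q1.
apply: le_trans (le_trans le _).
  rewrite ler_pM2l //.
  have E1 : \sum_(a in A) \sum_(b in A) (cone_form g (x (inl a)) (x (inl b)) == 0)%:R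
      = \sum_(a in A) \sum_(b in A) (dot a b == g)%:R :> R.
    apply: eq_bigr => a _; apply: eq_bigr => b _.
    by rewrite /x cone_form_row !mulr1 subr_eq0.
  have E2 : \sum_(a in A) \sum_(z in D) (cone_form g (x (inl a)) (x (inr z)) == 0)%:R = T.
    apply: eq_bigr => a _; apply: eq_bigr => z _.
    by rewrite /x cone_form_row !mulr0 subr0.
  have E3 : \sum_(z in D) \sum_(a in A) (cone_form g (x (inr z)) (x (inl a)) == 0)%:R = T.
    rewrite -E2 exchange_big; apply: eq_bigr => a _; apply: eq_bigr => z _.
    by rewrite cone_formC.
  (* Orthogonal pairs of two differences only enlarge the left side and are dropped. *)
  rewrite E1 E2 E3 -addrA lerD2l addrA -[leLHS]addr0.
  have -> : 2 * s * T = s * T + s * T by ring.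
  by rewrite lerD2l mulr_ge0 ?sqr_ge0 // sumr_ge0 // => z _; rewrite sumr_ge0.
rewrite lerD2l ler_pM2l ?divr_gt0 ?exprn_gt0 ?subr_gt0 //.
(* The last coordinate shows that a point is never collinear with a difference, and that two points
   are collinear only when equal. *)
have row1_neq0 (v : V) (t : F) (w : V) : row_mx v 1%:M <> t *: row_mx w 0%:M.
  move/rowP/(_ (rshift d 0)); rewrite [RHS]mxE !row_mxEr !mxE eqxx mul0rn mulr0 => /eqP.
  by rewrite (negPf (oner_neq0 F)).
have C1 : \sum_(a in A) \sum_(b in A) (collinear (x (inl a)) (x (inl b)))%:R = n.
  rewrite -sum1_card natr_sum; apply: eq_bigr => a aA.
  rewrite (bigD1 a) //= big1 => [|b /andP[_ ba]].
    rewrite addr0; congr (_%:R); apply/eqP; rewrite eqb1.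
    by apply/existsP; exists 1; rewrite scale1r.
  apply/eqP; rewrite pnatr_eq0 eqb0; apply/negP => /existsP[t /eqP].
  rewrite /x scale_row_mx => /eq_row_mx[ab].
  move/matrixP/(_ 0 0); rewrite !mxE eqxx mulr1 => t1.
  by move: ba; rewrite ab -t1 scale1r eqxx.
have C2 : \sum_(a in A) \sum_(z in D) (collinear (x (inl a)) (x (inr z)))%:R = 0 :> R.
  apply: big1 => a _; apply: big1 => z _; apply/eqP; rewrite pnatr_eq0 eqb0.
  by apply/negP => /existsP[t /eqP /row1_neq0].
have C3 : \sum_(z in D) \sum_(a in A) (collinear (x (inr z)) (x (inl a)))%:R = 0 :> R.
  apply: big1 => z; rewrite inE => /and4P[_ _ zz _].
  apply: big1 => a _; apply/eqP; rewrite pnatr_eq0 eqb0.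
  apply/negP => /existsP[t /eqP]; rewrite /x scale_row_mx => /eq_row_mx[E].
  move/matrixP/(_ 0 0); rewrite !mxE eqxx mulr1 mul0rn => t0.
  by move: E zz; rewrite -t0 scale0r -subr_eq0 => ->; rewrite eqxx.
have C4 : \sum_(z in D) \sum_(w in D) (collinear (x (inr z)) (x (inr w)))%:R
    = \sum_(z in D) \sum_(w in D) (collinear (z.1 - z.2) (w.1 - w.2))%:R :> R.
  apply: eq_bigr => z _; apply: eq_bigr => w _; congr (nat_of_bool _)%:R.
  apply: eq_existsb => t; rewrite /x scale_row_mx.
  apply/eqP/eqP => [/eq_row_mx[]//|->].
  by rewrite [0%:M]raddf0 scaler0.
by rewrite C1 C2 C3 C4 mulr0 addr0 add0r.
Qed.

Lemma card_isotropic_pairs_le_sq : #|D|%:R <= n ^+ 2.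
Proof.
rewrite -natrX ler_nat -mulnn -cardsX; apply: subset_leq_card.
by apply/subsetP => -[a c]; rewrite !inE /= => /and4P[-> ->].
Qed.

(** The case [s = 0] of [corner_bound], the difference of two points of [A] being isotropic exactly
    when their dot product is [g]. *)
Lemma card_isotropic_pairs_le : q * #|D|%:R <= n ^+ 2 + K * n.
Proof.
have q0 : 0 < q by apply: lt_trans (card_field_gt1 F R).
have := @corner_bound 0 (lexx 0).
rewrite mulr0 !mul0r !addr0 expr0n mul0r addr0; apply: le_trans.
rewrite ler_pM2l //.
have -> : \sum_(a in A) \sum_(b in A) (dot a b == g)%:R =
    \sum_(z | (z.1 \in A) && (z.2 \in A)) (dot z.1 z.2 == g)%:R :> R.
  by rewrite pair_big.
rewrite -sum1_card natr_sum big_mkcond [leRHS]big_mkcond /=.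
apply: ler_sum => -[a c] _; rewrite inE /=; case: ifP => [/and4P[aA cA _]|_].
  by rewrite isotropic_pair_dot // aA cA => ->.
by case: ifP.
Qed.

(** For a fixed [z], a collinear pair [w] is determined by its first point and the ratio of the two
    differences. *)
Lemma collinear_isotropic_pairs_le :
  \sum_(z in D) \sum_(w in D) (collinear (z.1 - z.2) (w.1 - w.2))%:R
    <= #|D|%:R * (n * q).
Proof.
rewrite mulr_natl -sumr_const; apply: ler_sum => z; rewrite inE => /and4P[_ _ zz _].
pose W := [set w in D | collinear (z.1 - z.2) (w.1 - w.2)].
have -> : \sum_(w in D) (collinear (z.1 - z.2) (w.1 - w.2))%:R = #|W|%:R :> R.
  rewrite -sum1_card natr_sum [RHS]big_mkcond [LHS]big_mkcond /=.
  by apply: eq_bigr => w _; rewrite !inE; case: ifP => _; case: (collinear _ _).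
rewrite -natrM ler_nat -cardsT -cardsX.
pose f (p : V * F) := (p.1, p.1 - p.2 *: (z.1 - z.2)).
apply: leq_trans (leq_imset_card f _); apply: subset_leq_card.
apply/subsetP => -[a c] /setIdP[]; rewrite inE /= => /and4P[aA _ _ _] col.
have z0 : z.1 - z.2 != 0 by rewrite subr_eq0.
have [t t0 E] := collinear_neq0 z0 col.
apply/imsetP; exists (a, t^-1); first by rewrite !inE aA.
by rewrite /f /= E scalerA mulVf // scale1r subKr.
Qed.

(** The weight [s = 1 / n] in [corner_bound] keeps the total weight of the differences at most [n],
    since there are at most [n ^+ 2] of them. *)
Lemma isotropic_corners_le : (0 < #|A|)%N ->
  2 * q * T <= 4 * n ^+ 3 + 2 * K * n ^+ 2 + K ^+ 2 * n.
Proof.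
move=> A0; have n0 : 0 < n by rewrite ltr0n.
have q1 : 1 < q := card_field_gt1 F R.
have q0 : 0 < q by apply: lt_trans q1.
have K0 : 0 < K by rewrite divr_gt0 ?exprn_gt0 ?subr_gt0.
have ninv0 : 0 <= n^-1 by rewrite invr_ge0 ltW.
have le := corner_bound ninv0.
have D1 := card_isotropic_pairs_le_sq; have D2 := card_isotropic_pairs_le.
have D3 := collinear_isotropic_pairs_le.
set Y := (\sum_(z in D) _) in le D3; set w := (#|D|%:R : R) in le D1 D2 D3.
set S := (\sum_(a in A) _) in le.
have S0 : 0 <= S by apply: sumr_ge0 => a _; apply: sumr_ge0.
have w0 : 0 <= w by rewrite ler0n.
have le1 : 2 * q * T / n <= (n + n^-1 * w) ^+ 2 + K * (n + n^-1 ^+ 2 * Y).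
  apply: le_trans le; rewrite mulrDr.
  have -> : q * (2 * n^-1 * T) = 2 * q * T / n by ring.
  by rewrite lerDr mulr_ge0 // ltW.
have wn : n^-1 * w <= n by rewrite mulrC ler_pdivrMr // -expr2.
have le2 : (n + n^-1 * w) ^+ 2 <= 4 * n ^+ 2.
  have : (n + n^-1 * w) ^+ 2 <= (n + n) ^+ 2.
    by rewrite ler_pXn2r ?nnegrE ?addr_ge0 ?lerD2l // ?mulr_ge0 // ltW.
  by move=> h; apply: le_trans h _; rewrite le_eqVlt; apply/orP; left; apply/eqP; ring.
(* The collinear mass is at most [q * w / n]; here the bound on the number of isotropic pairs is
   used. *)
have le3 : n^-1 ^+ 2 * Y <= n + K.
  apply: (@le_trans _ _ (n^-1 ^+ 2 * (w * (n * q)))).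
    by rewrite ler_wpM2l // exprn_ge0.
  have -> : n^-1 ^+ 2 * (w * (n * q)) = q * w / n by field; rewrite gt_eqF.
  by rewrite ler_pdivrMr // mulrDl -expr2.
have : 2 * q * T / n <= 4 * n ^+ 2 + K * (n + (n + K)).
  by apply: le_trans le1 _; rewrite lerD // ler_pM2l // lerD2l.
rewrite ler_pdivrMr // => h; apply: le_trans h _.
by rewrite le_eqVlt; apply/orP; left; apply/eqP; ring.
Qed.

(** A line through [c] in an anisotropic direction meets the sphere in at most one further point, so
    [orthogonal_pairs_bound] applies to the differences. The number [l] stands for the square root
    of [q ^+ d]. *)
Lemma anisotropic_corners_le (c : V) (l : R) : c \in A -> 0 < l -> l ^+ 2 = q ^+ d ->
  q * (\sum_(a in A) \sum_(b in A)
    ([&& dot (a - c) (a - c) != 0, dot (b - c) (b - c) != 0 &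
         dot (a - c) (b - c) == 0])%:R) <= n ^+ 2 + n * l.
Proof.
move=> cA l0 lE.
have q1 : 1 < q := card_field_gt1 F R.
pose A' := [set a in A | dot (a - c) (a - c) != 0].
pose X := [set a - c | a in A'].
have X0 : 0 \notin X.
  apply/imsetP => -[a /setIdP[_ ac] a0].
  by move: ac; rewrite -a0 dot0r eqxx.
have Xcol : {in X &, forall x y, collinear x y -> x = y}.
  move=> _ _ /imsetP[a /setIdP[aA ac] ->] /imsetP[b /setIdP[bA bc] ->] col.
  have a0 : a - c != 0 by apply: contraNneq ac => ->; rewrite dot0r.
  have [t t0 E] := collinear_neq0 a0 col.
  (* On differences from [c] the quadratic form agrees with a linear one; comparing how both scale
     forces the ratio [t] to be 1. *)
  have dotc e : e \in A -> dot (e - c) (e - c) = - 2%:R * dot c (e - c).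
    move=> eA; rewrite !dotBr !dotBl (dotA eA) (dotA cA) (dotC e c); ring.
  have := dotc a aA; rewrite E dotZr (dotC (t *: _)) !dotZr dotc // => /eqP.
  have -> : (t * (t * (- 2%:R * dot c (b - c))) == - 2%:R * (t * dot c (b - c)))
      = (t * (- 2%:R * dot c (b - c)) * (t - 1) == 0).
    by rewrite -[LHS]subr_eq0; congr (_ == _); ring.
  rewrite !mulf_eq0 (negPf t0) /= -mulf_eq0 -dotc // (negPf bc) /= subr_eq0.
  by move=> /eqP ->; rewrite scale1r.
have N_l : l ^+ 2 = #|V|%:R by rewrite lE card_mx mul1n natrX.
have := orthogonal_pairs_bound (@dotC F d) (@dotDr F d) (@dotZr F d) (@dot_nondeg F d)
  X0 Xcol l0 N_l.
have cX : #|X| = #|A'| by rewrite card_imset //; exact: addIr.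
have A'n : #|A'|%:R <= n.
  by rewrite ler_nat subset_leq_card //; apply/subsetP => a /setIdP[].
have bigX (f : V -> R) : \sum_(x in X) f x = \sum_(a in A') f (a - c).
  by rewrite big_imset // => a b _ _; exact: addIr.
rewrite bigX cX; under eq_bigr => a _ do rewrite bigX.
rewrite /ortho_kernel.
have -> : \sum_(a in A') \sum_(b in A') (q * (dot (a - c) (b - c) == 0)%:R - 1) =
    q * (\sum_(a in A') \sum_(b in A') (dot (a - c) (b - c) == 0)%:R)
      - #|A'|%:R ^+ 2.
  have -> : #|A'|%:R ^+ 2 = \sum_(a in A') \sum_(b in A') (1 : R).
    by rewrite sumr_const sumr_const expr2 mulr_natr.
  rewrite mulr_sumr -sumrB; apply: eq_bigr => a _.
  by rewrite mulr_sumr -sumrB.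
have toA (f : V -> R) : \sum_(a in A') f a =
    \sum_(a in A) (dot (a - c) (a - c) != 0)%:R * f a.
  rewrite (eq_bigl (fun a => (a \in A) && (dot (a - c) (a - c) != 0))) => [|a].
    rewrite big_mkcondr; apply: eq_bigr => a _.
    by case: ifP; rewrite ?mul1r ?mul0r.
  by rewrite inE.
have -> : \sum_(a in A') \sum_(b in A') (dot (a - c) (b - c) == 0)%:R =
    \sum_(a in A) \sum_(b in A) ([&& dot (a - c) (a - c) != 0,
      dot (b - c) (b - c) != 0 & dot (a - c) (b - c) == 0])%:R :> R.
  rewrite toA; apply: eq_bigr => a _; rewrite toA mulr_sumr.
  by apply: eq_bigr => b _; rewrite -!natrM !mulnb.
move=> h; rewrite lerBlDr in h; apply: le_trans h _.
rewrite addrC lerD //; first by rewrite ler_pXn2r ?nnegrE.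
by rewrite ler_pM2r.
Qed.

(** The fourth point is [e = a + b - c], and the condition that it has norm [g] becomes, up to the
    invertible factor 2, the orthogonality of [a - c] and [b - c]. *)
Lemma energy_le_corners :
  (energy A)%:R <= \sum_(c in A) \sum_(a in A) \sum_(b in A)
     (dot (a - c) (b - c) == 0)%:R :> R.
Proof.
pose f (t : (V * V) * (V * V)) := (t.2.1, (t.1.1, t.1.2)).
pose P := [set p : V * (V * V) | [&& p.1 \in A, p.2.1 \in A, p.2.2 \in A &
  dot (p.2.1 - p.1) (p.2.2 - p.1) == 0]].
have -> : \sum_(c in A) \sum_(a in A) \sum_(b in A)
     (dot (a - c) (b - c) == 0)%:R = #|P|%:R :> R.
  under eq_bigr => c _ do rewrite pair_big /=.
  rewrite pair_big /= -sum1_card natr_sum big_mkcond [RHS]big_mkcond /=.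
  apply: eq_bigr => -[c [a b]] _; rewrite inE /=.
  by case: (c \in A); case: (a \in A); case: (b \in A) => //=; case: (_ == _).
rewrite ler_nat /energy -(card_in_imset (f := f)); last first.
  move=> [[a b] [c e]] [[a' b'] [c' e']]; rewrite !inE /=.
  case/and5P=> _ _ _ _ /eqP E; case/and5P=> _ _ _ _ /eqP E'; case=> cc aa bb.
  by move: E'; rewrite -aa -bb -cc E => /addrI ->.
apply: subset_leq_card; apply/subsetP => p /imsetP[[[a b] [c e]]].
rewrite !inE /= => /and5P[aA bA cA eA /eqP E] ->; rewrite /f /= aA bA cA /=.
have eE : e = a + b - c by rewrite E addrC addKr.
have H := dotA eA; rewrite eE dotBr !dotBl !dotDr !dotDl !dotA // in H.
rewrite (dotC c a) (dotC c b) (dotC b a) in H.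
rewrite dotBr !dotBl !dotA // (dotC c b); apply/eqP.
have : 2%:R * (dot a b - dot b c - (dot a c - g)) = 0.
  by rewrite -[RHS](subrr g) -{2}H; ring.
by move=> /eqP; rewrite mulf_eq0 (negPf two_neq0) => /eqP.
Qed.

(** Either both sides are anisotropic, or one is isotropic and nonzero, or one is zero. The cases
    may overlap, whence only an inequality. *)
Lemma corner_cases (a b c : V) : a \in A -> b \in A -> c \in A ->
  ((dot (a - c) (b - c) == 0)%:R : R) <=
    [&& dot (a - c) (a - c) != 0, dot (b - c) (b - c) != 0 &
         dot (a - c) (b - c) == 0]%:R
    + ((a, c) \in D)%:R * (dot b (a - c) == 0)%:R
    + ((b, c) \in D)%:R * (dot a (b - c) == 0)%:R
    + (a == c)%:R + (b == c)%:R.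
Proof.
have Ddot (x y z : V) : x \in A -> z \in A -> dot (x - z) (x - z) == 0 ->
    dot (x - z) (y - z) = dot y (x - z).
  move=> xA zA; rewrite isotropic_pair_dot // => /eqP xz.
  by rewrite dotBr !(dotC (x - z)) [dot z _]dotBr (dotC z x) xz dotA // subrr subr0.
move=> aA bA cA; case: (boolP (dot _ (b - c) == 0)) => [ab|_]; last first.
  by rewrite !addr_ge0 ?mulr_ge0.
have [->|ac] := eqVneq a c; first by rewrite addrAC lerDr !addr_ge0 ?mulr_ge0.
have [->|bc] := eqVneq b c; first by rewrite lerDr !addr_ge0 ?mulr_ge0.
rewrite !addr0 !inE /= aA bA cA ac bc /=.
have [a0|_] /= := boolP (dot (a - c) (a - c) == 0).
  by rewrite -(Ddot _ b _ aA cA a0) ab mul1r add0r lerDl mulr_ge0.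
have [b0|_] /= := boolP (dot (b - c) (b - c) == 0).
  by rewrite -(Ddot _ a _ bA cA b0) (dotC (b - c)) ab mul1r mul0r !add0r.
by rewrite !mul0r !addr0.
Qed.

Lemma sum_corner_cases :
  \sum_(c in A) \sum_(a in A) \sum_(b in A) (dot (a - c) (b - c) == 0)%:R <=
    \sum_(c in A) (\sum_(a in A) \sum_(b in A)
      [&& dot (a - c) (a - c) != 0, dot (b - c) (b - c) != 0 &
          dot (a - c) (b - c) == 0]%:R) + 2 * T + 2 * n ^+ 2 :> R.
Proof.
have TE : \sum_(c in A) \sum_(a in A) \sum_(b in A)
    ((a, c) \in D)%:R * (dot b (a - c) == 0)%:R = T.
  rewrite /isotropic_corners [RHS]exchange_big /= exchange_big pair_big /=.
  rewrite big_mkcond [RHS]big_mkcond.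
  apply: eq_bigr => -[a c] _ /=; case: ifP => [_|acA].
    rewrite -mulr_sumr; case: ifP => _; by rewrite ?mul1r ?mul0r.
  by case: ifP => //; rewrite inE /= => /and4P[aA cA]; rewrite aA cA in acA.
have TE' : \sum_(c in A) \sum_(a in A) \sum_(b in A)
    ((b, c) \in D)%:R * (dot a (b - c) == 0)%:R = T.
  by rewrite -TE; apply: eq_bigr => c _; rewrite exchange_big.
have nE : \sum_(c in A) \sum_(a in A) \sum_(b in A) (a == c)%:R = n ^+ 2.
  rewrite expr2 mulr_natl -sumr_const; apply: eq_bigr => c cA.
  rewrite (bigD1 c) //= [X in _ + X]big1 => [|a /andP[_ /negPf ac]].
    by rewrite addr0 eqxx sumr_const.
  by rewrite big1 // => b _; rewrite ac.
have nE' : \sum_(c in A) \sum_(a in A) \sum_(b in A) (b == c)%:R = n ^+ 2.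
  by rewrite -nE; apply: eq_bigr => c _; rewrite exchange_big.
pose sum3 (f : V -> V -> V -> R) := \sum_(c in A) \sum_(a in A) \sum_(b in A) f c a b.
have sum3D f h : sum3 (fun c a b => f c a b + h c a b) = sum3 f + sum3 h.
  rewrite -big_split; apply: eq_bigr => c _; rewrite -big_split.
  by apply: eq_bigr => a _; rewrite -big_split.
set S := (X in X + _ + _); have SE : sum3 _ = S := erefl.
have -> : S + 2 * T + 2 * n ^+ 2 = S + T + T + n ^+ 2 + n ^+ 2 by ring.
have TE1 : sum3 _ = T := TE; have TE2 : sum3 _ = T := TE'.
have nE1 : sum3 _ = n ^+ 2 := nE; have nE2 : sum3 _ = n ^+ 2 := nE'.
rewrite -{1}TE1 -TE2 -{1}nE1 -nE2 -SE -!sum3D.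
by do 3!apply: ler_sum => ? ?; apply: corner_cases.
Qed.

Lemma sphere_energy_le (l : R) : (0 < #|A|)%N -> 0 < l -> l ^+ 2 = q ^+ d ->
  (energy A)%:R <= (n ^+ 3 + n ^+ 2 * l) / q
    + (4 * n ^+ 3 + 2 * K * n ^+ 2 + K ^+ 2 * n) / q + 2 * n ^+ 2.
Proof.
move=> A0 l0 lE; have q0 : 0 < q by apply: lt_trans (card_field_gt1 F R).
apply: le_trans energy_le_corners _; apply: le_trans sum_corner_cases _.
rewrite lerD2r lerD //.
  rewrite ler_pdivlMr // mulrC mulr_sumr.
  have -> : n ^+ 3 + n ^+ 2 * l = \sum_(c in A) (n ^+ 2 + n * l).
    by rewrite sumr_const -mulr_natl; ring.
  by apply: ler_sum => c cA; apply: anisotropic_corners_le.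
by rewrite ler_pdivlMr // mulrAC; apply: isotropic_corners_le.
Qed.

Lemma energy_le_cube : (energy A)%:R <= n ^+ 3.
Proof.
apply: le_trans energy_le_corners _.
have -> : n ^+ 3 = \sum_(c in A) \sum_(a in A) \sum_(b in A) 1.
  by rewrite !sumr_const -!mulrnA -natrX !expnS expn0 muln1 mulnA.
by do 3![apply: ler_sum => ? _]; rewrite lern1 leq_b1.
Qed.

End SphereEnergy.

(** * Comparison of the error terms and conclusion *)

(** Here [s] is the square root of [q], [r] is [s ^+ (d - 2)] and [r * s ^+ 2] is the [l] above. The
    assumption [r <= n] absorbs the term in [K ^+ 2]. *)
Lemma corner_terms_le (R : realFieldType) (n r s K : R) :
  1 <= s -> 1 <= r -> r <= n -> 0 <= K -> K <= 2 * r * s ->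
  (n ^+ 3 + n ^+ 2 * (r * s ^+ 2)) / s ^+ 2
    + (4 * n ^+ 3 + 2 * K * n ^+ 2 + K ^+ 2 * n) / s ^+ 2 + 2 * n ^+ 2
  <= 11 * (n ^+ 3 / s ^+ 2 + r * n ^+ 2).
Proof.
move=> s1 r1 rn K0 Kle.
have s0 : 0 < s by lra.
have r0 : 0 < r by lra.
have n0 : 0 < n by lra.
have s2 : 0 < s ^+ 2 by rewrite exprn_gt0.
have n2 : 0 <= n ^+ 2 by rewrite sqr_ge0.
have n3 : 0 <= n ^+ 3 / s ^+ 2 by rewrite divr_ge0 ?exprn_ge0 // ltW.
have Ks : K / s ^+ 2 <= 2 * r.
  rewrite ler_pdivrMr //; apply: le_trans Kle _.
  by rewrite ler_pM2l ?mulr_gt0 // expr2 ler_peMl // ltW.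
have Ks2 : K ^+ 2 / s ^+ 2 <= 4 * r * n.
  rewrite ler_pdivrMr //; apply: (@le_trans _ _ ((2 * r * s) ^+ 2)).
    by rewrite ler_pXn2r ?nnegrE // !mulr_ge0 // ltW.
  have -> : (2 * r * s) ^+ 2 = 4 * r * r * s ^+ 2 by ring.
  by rewrite ler_pM2r // ler_pM2l // mulr_gt0.
have t1 : K / s ^+ 2 * n ^+ 2 <= 2 * r * n ^+ 2 by rewrite ler_wpM2r.
have t2 : K ^+ 2 / s ^+ 2 * n <= 4 * r * n * n by rewrite ler_pM2r.
have t3 : n ^+ 2 <= r * n ^+ 2 by rewrite ler_peMl.
have -> : (n ^+ 3 + n ^+ 2 * (r * s ^+ 2)) / s ^+ 2
    + (4 * n ^+ 3 + 2 * K * n ^+ 2 + K ^+ 2 * n) / s ^+ 2 + 2 * n ^+ 2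
  = 5 * (n ^+ 3 / s ^+ 2) + r * n ^+ 2 + 2 * (K / s ^+ 2 * n ^+ 2)
    + K ^+ 2 / s ^+ 2 * n + 2 * n ^+ 2.
  by field; rewrite gt_eqF.
have t2' : K ^+ 2 / s ^+ 2 * n <= 4 * (r * n ^+ 2).
  by apply: le_trans t2 _; rewrite expr2 !mulrA.
(* The coefficient of the cubic term is 5; that of [r * n ^+ 2] is [1 + 4 + 4 + 2 = 11]. *)
lra.
Qed.

Lemma sphere_energy_bound (R : rcfType) (F : finFieldType) (g : F) (m k : nat)
    (A : {set 'rV[F]_(2 * m.+1).+1}) :
  odd #|F| -> (#|F|.-1).-primitive_root g -> (0 < k)%N ->
  ((2 * m.+1).+1 = 4 * k - 1 /\ #|F| %% 4 = 1)%N \/ ((2 * m.+1).+1 = 4 * k + 1)%N ->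
  A \subset sphere (2 * m.+1).+1 g ->
  (energy A)%:R <= 11 * (#|A|%:R ^+ 3 / #|F|%:R
    + Num.sqrt #|F|%:R ^+ ((2 * m.+1).+1 - 2) * #|A|%:R ^+ 2) :> R.
Proof.
move=> oddF prim_g k0 dE sA; set q : R := #|F|%:R; set n : R := #|A|%:R.
pose s := Num.sqrt q; rewrite -/s.
have q2 : 2 <= q by rewrite ler_nat finNzRing_gt1.
have sq : s ^+ 2 = q by rewrite sqr_sqrtr //; lra.
have s0 : 0 <= s by rewrite sqrtr_ge0.
have s1 : 1 <= s by rewrite -sqrtr1 ler_wsqrtr //; lra.
set r := s ^+ _.
have r1 : 1 <= r by rewrite exprn_ege1.
have E3 := energy_le_cube R oddF prim_g sA.
have n0 : 0 <= n by rewrite ler0n.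
(* For [n <= r] the trivial cubic bound is already at most [r * n ^+ 2]. *)
have [nr|rn] := leP n r.
  apply: le_trans E3 _; rewrite -/n.
  have t1 : n ^+ 3 <= r * n ^+ 2 by rewrite exprS ler_wpM2r ?sqr_ge0.
  have t2 : 0 <= n ^+ 3 / q by rewrite divr_ge0 ?exprn_ge0 //; lra.
  have t3 : 0 <= n ^+ 3 by rewrite exprn_ge0.
  lra.
have A0 : (0 < #|A|)%N by rewrite -(ltr0n R) -/n; lra.
have lE : (r * s ^+ 2) ^+ 2 = q ^+ (2 * m.+1).+1.
  rewrite /r -exprD -sq -!exprM.
  by have -> : (((2 * m.+1).+1 - 2 + 2) * 2 = 2 * (2 * m.+1).+1)%N by clear; lia.
have l0 : 0 < r * s ^+ 2 by rewrite mulr_gt0 ?exprn_gt0 //; lra.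
apply: le_trans (sphere_energy_le oddF prim_g k0 dE sA A0 l0 lE) _.
have qm1 : 0 < q - 1 by lra.
have K0 : 0 <= q ^+ m.+2 / (q - 1) by rewrite divr_ge0 ?exprn_ge0 //; lra.
(* The factor 2 comes from [q <= 2 * (q - 1)]. *)
have Kle : q ^+ m.+2 / (q - 1) <= 2 * r * s.
  have -> : 2 * r * s = 2 * q ^+ m.+1.
    rewrite -mulrA /r -exprSr -sq -exprM.
    by have -> : (((2 * m.+1).+1 - 2).+1 = 2 * m.+1)%N by clear; lia.
  rewrite ler_pdivrMr // exprSr mulrAC -subr_ge0.
  have -> : 2 * (q - 1) * q ^+ m.+1 - q ^+ m.+1 * q = (q - 2) * q ^+ m.+1 by ring.
  by rewrite mulr_ge0 ?exprn_ge0 //; lra.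
have := corner_terms_le s1 r1 (ltW rn) K0 Kle.
by rewrite -/q -/n sq.
Qed.

Theorem theorem2p5 :
  forall d : nat, exists C : Rdefinitions.R, 0 < C /\
  forall (F : finFieldType) (g : F) (k : nat),
    odd #|F| ->
    (#|F|.-1).-primitive_root g ->
    (0 < k)%N ->
    ((d = 4 * k - 1 /\ #|F| %% 4 = 1) \/ d = 4 * k + 1)%N ->
    forall A : {set 'rV[F]_d}, A \subset sphere d g ->
      ((energy A)%:R : Rdefinitions.R) <=
        C * ((#|A|%:R) ^+ 3 / (#|F|%:R)
             + (Num.sqrt (#|F|%:R)) ^+ (d - 2) * (#|A|%:R) ^+ 2).
Proof.
(* The same constant serves for every [d]. *)
move=> d; exists 11; split; first by rewrite ltr0n.
move=> F g k oddF prim_g k0 dE.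
(* Both cases make [d] odd and at least 3, so the truncated subtraction in [d - 2] is exact. *)
have [m dm] : exists m, d = (2 * m.+1).+1.
  by exists ((d - 3)./2); move: dE; rewrite mulnE; lia.
subst d => A sA.
exact: sphere_energy_bound oddF prim_g k0 dE sA.
Qed.
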